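(* For every approximation space $(Ob, R)$, let $B^{\ast} = \{(LX, MX) : X \subseteq Ob\}$ be the collection of all its rough sets, equipped with the operations $\wedge, \vee, \sim, \bigtriangledown$ and the constant $1 = (Ob, Ob)$ defined in the context. Then the system $(B^{\ast}, \wedge, \vee, \sim, \bigtriangledown, 1)$ is a three-valued Łukasiewicz algebra.
   Context: An approximation space is a pair $(Ob, R)$ where $Ob$ is a nonempty set and $R$ is an equivalence relation on $Ob$. For $x \in Ob$, $\vert x \vert$ denotes the $R$-equivalence class of $x$, and $R^{\ast}$ is the set of all equivalence classes. For $X \subseteq Ob$ write $\neg X = Ob \setminus X$ and $$MX = \bigcup \{C \in R^{\ast} : C \cap X \neq \emptyset\}, \qquad LX = \neg M \neg X = \bigcup \{C \in R^{\ast} : C \subseteq X\}.$$ A rough set of $(Ob,R)$ is a pair $(LX, MX)$ with $X \subseteq Ob$. Operations on $B^{\ast} = \{(LX,MX) : X \subseteq Ob\}$: $$(LX, MX) \wedge (LY, MY) = (LX \cap LY,\ MX \cap MY),$$ $$(LX, MX) \vee (LY, MY) = (LX \cup LY,\ MX \cup MY),$$ $$\sim (LX, MX) = (L \neg MX,\ M \neg LX) = (L \neg X,\ M \neg X),$$ $$\bigtriangledown (LX, MX) = (LMX,\ MMX) = (MX, MX),$$ $$0 = (\emptyset, \emptyset), \qquad 1 = (Ob, Ob).$$ (It is known that these pairs belong to $B^{\ast}$: the meet is $(LU, MU)$ with $U = MX \cap Y \cap (X \cup M\neg Y)$ and the join is $(LV, MV)$ with $V = LX \cup Y \cup (X \cap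 L \neg Y)$.) A De Morgan algebra $(A, \wedge, \vee, \sim, 1)$ is a distributive lattice $(A, \wedge, \vee)$ with greatest element $1$ and a unary operation $\sim$ satisfying $\sim\sim x = x$ and $\sim(x \wedge y) = \sim x\ \vee \sim y$; its least element is $0 = \sim 1$. A three-valued Łukasiewicz algebra is an algebra $(A, \wedge, \vee, \sim, \bigtriangledown, 1)$ of type $(2,2,1,1,0)$ such that $(A, \wedge, \vee, \sim, 1)$ is a De Morgan algebra and, for all $x, y \in A$: $\sim x \vee \bigtriangledown x = 1$; $x\, \wedge \sim x = \ \sim x \wedge \bigtriangledown x$; $\bigtriangledown(x \wedge y) = \bigtriangledown x \wedge \bigtriangledown y$. *)

(* Defs.v *)
From mathcomp Require Import all_boot.
From mathcomp Require Import boolp classical_sets.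
From Stdlib Require Import RelationClasses.

Set Implicit Arguments.
Unset Strict Implicit.
Unset Printing Implicit Defensive.

Local Open Scope classical_set_scope.

Record is_distributive_lattice (A : Type) (meet join : A -> A -> A) : Prop := {
  dl_meetC : commutative meet;
  dl_joinC : commutative join;
  dl_meetA : associative meet;
  dl_joinA : associative join;
  dl_joinKI : forall x y : A, meet x (join x y) = x;
  dl_meetKU : forall x y : A, join x (meet x y) = x;
  dl_meetUl : left_distributive meet join
}.

(* [dm_top] says x <= 1 in the lattice order, x <= y being x /\ y = x. *)
Record is_de_morgan_algebra (A : Type) (meet join : A -> A -> A)
    (neg : A -> A) (one : A) : Prop := {
  dm_lattice : is_distributive_lattice meet join;
  dm_top : forall x : A, meet x one = x;
  dm_negK : involutive neg;
  dm_neg_meet : {morph neg : x y / meet x y >-> join x y}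
}.

Record is_lukasiewicz3_algebra (A : Type) (meet join : A -> A -> A)
    (neg nabla : A -> A) (one : A) : Prop := {
  luk3_de_morgan : is_de_morgan_algebra meet join neg one;
  luk3_join_nabla : forall x : A, join (neg x) (nabla x) = one;
  luk3_meet_nabla : forall x : A, meet x (neg x) = meet (neg x) (nabla x);
  luk3_nabla_meet : {morph nabla : x y / meet x y}
}.

Record approxSpace := ApproxSpace {
  ob :> Type;
  indisc : ob -> ob -> Prop;
  ob_inhabited : inhabited ob;
  indisc_equiv : Equivalence indisc
}.

Section RoughSets.
Variable S : approxSpace.
Implicit Types X Y C : set S.

Definition eqclass (x : S) : set S := [set y | indisc x y].

(* R^*, the set of all equivalence classes. *)
Definition eqclasses : set (set S) := range eqclass.

(* M *)
Definition upper X : set S :=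
  \bigcup_(C in [set C | eqclasses C /\ C `&` X !=set0]) C.

(* L *)
Definition lower X : set S := ~` upper (~` X).

Definition roughpair X : set S * set S := (lower X, upper X).

(* B^*; used as a type, it is coerced to {p | p \in rough_sets}. *)
Definition rough_sets : set (set S * set S) := range roughpair.

Lemma upperE X : upper X = [set x | exists2 y, indisc x y & X y].
Proof.
have [rR sR tR] := indisc_equiv S.
apply/seteqP; split => x /=.
- case=> C [[z _ <-] [y [Czy Xy]]] Czx; exists y => //.
  exact: tR (sR _ _ Czx) Czy.
- case=> y Rxy Xy; exists (eqclass x); last exact: rR.
  by split; [exists x | exists y].
Qed.

Lemma lowerE X : lower X = [set x | forall y, indisc x y -> X y].
Proof.
rewrite /lower upperE; apply/seteqP; split => x /=.
- by move=> H y Rxy; apply: contrapT => nXy; apply: H; exists y.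
- by move=> H [y Rxy]; apply; apply: H.
Qed.

Lemma lower_bigcup X :
  lower X = \bigcup_(C in [set C | eqclasses C /\ C `<=` X]) C.
Proof.
have [rR sR tR] := indisc_equiv S.
rewrite lowerE; apply/seteqP; split => x /=.
- by move=> H; exists (eqclass x); [split; [exists x|] | exact: rR].
- by case=> C [[z _ <-] sub] Rzx y Rxy; apply/sub/(tR _ _ _ Rzx).
Qed.

Lemma roughpair_meet X Y :
  roughpair (upper X `&` Y `&` (X `|` upper (~` Y))) =
  (lower X `&` lower Y, upper X `&` upper Y).
Proof.
have [rR sR tR] := indisc_equiv S.
rewrite /roughpair !upperE !lowerE; congr pair; apply/seteqP; split => x /=.
- move=> H; have HY y : indisc x y -> Y y by case/H => -[].
  split=> // y Rxy; case: (H y Rxy) => _ [//|[z Ryz []]].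
  exact/HY/(tR _ _ _ Rxy).
- case=> HX HY y Rxy; split; [split|left]; [|exact: HY|exact: HX].
  by exists y; [exact: rR | exact: HX].
- by case=> y Rxy [[[z Ryz Xz] Yy] _]; split;
    [exists z => //; exact: tR Rxy Ryz | exists y].
- case=> -[z Rxz Xz] [y Rxy Yy].
  have [[w Rxw nYw]|nH] := pselect (exists2 w, indisc x w & ~ Y w).
    exists y => //; split; first split=> //.
      by exists z => //; exact: tR (sR _ _ Rxy) Rxz.
    by right; exists w => //; exact: tR (sR _ _ Rxy) Rxw.
  exists z => //; split; last by left.
  split; first by exists z.
  by apply: contrapT => nYz; apply: nH; exists z.
Qed.

Lemma roughpair_join X Y :
  roughpair (lower X `|` Y `|` (X `&` lower (~` Y))) =
  (lower X `|` lower Y, upper X `|` upper Y).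
Proof.
have [rR sR tR] := indisc_equiv S.
rewrite /roughpair !upperE !lowerE; congr pair; apply/seteqP; split => x /=.
- move=> H.
  have [HY|/existsNP[y /not_implyP[Rxy nYy]]] :=
    pselect (forall y, indisc x y -> Y y); [by right|left => z Rxz].
  have nY w : indisc x w -> X w.
    move=> Rxw; case: (H y Rxy) => [[HX|//]|[_ nY]].
      exact/HX/(tR _ _ _ (sR _ _ Rxy)).
    case: (H w Rxw) => [[HX|Yw]|[]//]; first exact/HX/rR.
    by case: (nY w) => //; exact: tR (sR _ _ Rxy) Rxw.
  exact: nY.
- case=> H y Rxy; left; [left=> z Ryz|right; exact: H].
  exact/H/(tR _ _ _ Rxy).
- case=> y Rxy [[HX|Yy]|[Xy _]]; [left|by right; exists y|by left; exists y].
  by exists y => //; exact/HX/rR.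
- have [[y Rxy Yy] _|nY] := pselect (exists2 y, indisc x y & Y y).
    by exists y => //; left; right.
  case=> [[y Rxy Xy]|//]; exists y => //; right; split=> // z Ryz Yz.
  by apply: nY; exists z => //; exact: tR Rxy Ryz.
Qed.

Lemma upper_upper X : upper (upper X) = upper X.
Proof.
have [rR sR tR] := indisc_equiv S.
rewrite !upperE; apply/seteqP; split => x /=.
- by case=> y Rxy [z Ryz Xz]; exists z => //; exact: tR Rxy Ryz.
- by case=> y Rxy Xy; exists x; [exact: rR | exists y].
Qed.

Lemma lower_upper X : lower (upper X) = upper X.
Proof.
have [rR sR tR] := indisc_equiv S.
rewrite lowerE upperE; apply/seteqP; split => x /=; first by apply; exact: rR.
by case=> z Rxz Xz y Rxy; exists z => //; exact: tR (sR _ _ Rxy) Rxz.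
Qed.

Lemma roughpair_neg X :
  (lower (~` upper X), upper (~` lower X)) = roughpair (~` X).
Proof. by rewrite /roughpair /lower !setCK !upper_upper. Qed.

Lemma roughpair_nabla X :
  (lower (upper X), upper (upper X)) = (upper X, upper X).
Proof. by rewrite lower_upper upper_upper. Qed.

Lemma rough_meet_subproof (p q : rough_sets) :
  ((val p).1 `&` (val q).1, (val p).2 `&` (val q).2) \in rough_sets.
Proof.
case: p q => [_ /= /set_mem[X _ <-]] [_ /= /set_mem[Y _ <-]].
by apply/mem_set; eexists; last exact: roughpair_meet.
Qed.

Lemma rough_join_subproof (p q : rough_sets) :
  ((val p).1 `|` (val q).1, (val p).2 `|` (val q).2) \in rough_sets.
Proof.
case: p q => [_ /= /set_mem[X _ <-]] [_ /= /set_mem[Y _ <-]].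
by apply/mem_set; eexists; last exact: roughpair_join.
Qed.

Lemma rough_neg_subproof (p : rough_sets) :
  (lower (~` (val p).2), upper (~` (val p).1)) \in rough_sets.
Proof.
case: p => [_ /= /set_mem[X _ <-]].
by apply/mem_set; exists (~` X); last rewrite -roughpair_neg.
Qed.

Lemma rough_nabla_subproof (p : rough_sets) :
  (lower (val p).2, upper (val p).2) \in rough_sets.
Proof.
case: p => [_ /= /set_mem[X _ <-]].
by apply/mem_set; exists (upper X).
Qed.

Lemma rough_one_subproof : ([set: S], [set: S]) \in rough_sets.
Proof.
have [rR _ _] := indisc_equiv S.
apply/mem_set; exists setT => //; rewrite /roughpair lowerE upperE.
by congr pair; apply/seteqP; split => x //= _; exists x.
Qed.

Definition rough_meet (p q : rough_sets) : rough_sets :=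
  SigSub (rough_meet_subproof p q).

Definition rough_join (p q : rough_sets) : rough_sets :=
  SigSub (rough_join_subproof p q).

Definition rough_neg (p : rough_sets) : rough_sets :=
  SigSub (rough_neg_subproof p).

Definition rough_nabla (p : rough_sets) : rough_sets :=
  SigSub (rough_nabla_subproof p).

Definition rough_one : rough_sets := SigSub rough_one_subproof.

End RoughSets.

Arguments rough_meet : clear implicits.
Arguments rough_join : clear implicits.
Arguments rough_neg : clear implicits.
Arguments rough_nabla : clear implicits.
Arguments rough_one : clear implicits.

(* Main.v *)
(** Writing a rough set as a pair (a, b) with [a `<=` b], negation is (~b, ~a) and
    nabla is (b, b), because the two components are unions of equivalence classes
    and hence fixed by L and M. All the axioms are then identities of the
    Boolean algebra of subsets, valid for every such pair. *)

Require Import Defs.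
From mathcomp Require Import all_boot.
From mathcomp Require Import boolp classical_sets.

Local Open Scope classical_set_scope.

Section RoughSetComponents.
Variable S : approxSpace.
Implicit Types p q r : @rough_sets S.

Lemma lower_subset_upper (X : set S) : lower X `<=` upper X.
Proof.
have [rR _ _] := indisc_equiv S.
by rewrite lowerE upperE => x HX; exists x; [exact: rR | exact/HX/rR].
Qed.

(** The one relation between the two components that the Łukasiewicz axioms need beyond Boolean
    identities. *)
Lemma rough_val_subset p : (val p).1 `<=` (val p).2.
Proof. case: p => [_ /= /set_mem[X _ <-]]; exact: lower_subset_upper. Qed.

Lemma rough_val_meet p q :
  val (rough_meet S p q) =
  ((val p).1 `&` (val q).1, (val p).2 `&` (val q).2).
Proof. by []. Qed.

Lemma rough_val_join p q :
  val (rough_join S p q) =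
  ((val p).1 `|` (val q).1, (val p).2 `|` (val q).2).
Proof. by []. Qed.

(** Unfolding L as the dual of M leaves M applied twice in each component, and M is idempotent. *)
Lemma rough_val_neg p : val (rough_neg S p) = (~` (val p).2, ~` (val p).1).
Proof.
case: p => [_ /= /set_mem[X _ <-]] /=.
by rewrite /lower !setCK !upper_upper.
Qed.

Lemma rough_val_nabla p : val (rough_nabla S p) = ((val p).2, (val p).2).
Proof. case: p => [_ /= /set_mem[X _ <-]]; exact: roughpair_nabla. Qed.

(** Membership proofs are irrelevant, so each axiom splits into two equations between sets. *)
Lemma rough_eq p q :
  (val p).1 = (val q).1 -> (val p).2 = (val q).2 -> p = q.
Proof.
by case: p q => [[a b] ?] [[c d] ?] /= ac bd; apply: val_inj; rewrite /= ac bd.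
Qed.

Lemma rough_distributive_lattice :
  is_distributive_lattice (rough_meet S) (rough_join S).
Proof.
split=> [p q|p q|p q r|p q r|p q|p q|p q r]; apply: rough_eq => /=.
- exact: setIC.
- exact: setIC.
- exact: setUC.
- exact: setUC.
- exact: setIA.
- exact: setIA.
- exact: setUA.
- exact: setUA.
- by rewrite setUC setKU.
- by rewrite setUC setKU.
- by rewrite setIC setKI.
- by rewrite setIC setKI.
- exact: setIUl.
- exact: setIUl.
Qed.

Lemma rough_de_morgan_algebra :
  is_de_morgan_algebra (rough_meet S) (rough_join S) (rough_neg S)
    (rough_one S).
Proof.
split=> [|p|p|p q]; first exact: rough_distributive_lattice.
- by apply: rough_eq; rewrite /= setIT.
- by apply: rough_eq; rewrite !rough_val_neg /= setCK.
- by apply: rough_eq; rewrite rough_val_join !rough_val_neg /= setCI.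
Qed.

End RoughSetComponents.

Theorem theorem3p1 (S : approxSpace) :
  is_lukasiewicz3_algebra (rough_meet S) (rough_join S) (rough_neg S)
    (rough_nabla S) (rough_one S).
Proof.
split=> [|p|p|p q]; first exact: rough_de_morgan_algebra.
- apply: rough_eq; rewrite rough_val_join rough_val_neg rough_val_nabla /=.
  by rewrite setUC setUv.
  (* For p = (a, b), the second component asks that ~a and b cover everything: a point outside ~a
     lies in a, hence in b. *)
  rewrite -subTset => x _; have [ax|] := pselect ((val p).1 x); last by left.
  by right; exact: rough_val_subset.
- apply: rough_eq; rewrite !rough_val_meet rough_val_neg rough_val_nabla /=.
  (* In the first component both sides are empty: b misses its complement, and a misses ~b because a
     is contained in b. *)
  rewrite setICl; apply/disjoints_subset; rewrite setCK.
  exact: rough_val_subset.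
  exact: setIC.
- by apply: rough_eq; rewrite rough_val_meet !rough_val_nabla.
Qed.
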